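(* Let $R$ be a commutative principal ideal ring with identity and $M$ a finitely generated faithful multiplication $R$-module. The following conditions are equivalent: (i) $M$ is zero-dimensional. (ii) Property ( * ) holds for the family of all submodules of $M$. (iii) Property ( * ) holds for the family of all primary submodules of $M$.
   Context: All modules are unital. A principal ideal ring is a ring in which every ideal is principal (it need not be a domain). A multiplication module is an $R$-module $M$ such that each submodule $N$ of $M$ is of the form $N=IM$ for some ideal $I$ of $R$. A prime submodule of $M$ is a proper submodule $P$ such that $rm\in P$ with $r\in R$, $m\in M$ implies $m\in P$ or $rM\subseteq P$. A primary submodule of $M$ is a proper submodule $Q$ such that $rm\in Q$ with $r\in R$, $m\in M$ implies $m\in Q$ or $r^kM\subseteq Q$ for some $k\geq 1$. $M$ is zero-dimensional if every prime submodule of $M$ is maximal (equivalently for finitely generated $M$, there are no two prime submodules $P\subsetneq Q$ of $M$). The radical $\text{rad}(N)$ of a submodule $N$ of $M$ is the intersection of all prime submodules of $M$ containing $N$ (equal to $M$ if there are none). In a multiplication module $M$, the product of submodules $N=IM$ and $K=JM$ is $(IJ)M$ (this is independent of the choice of $I,J$), and the product of elements $m,m'\in M$ is the product of the submodules $Rm$ and $Rm'$; thus, for $x\in M$ with $Rx=IM$, $x^n$ denotes the submodule $I^nM$. A family $\{N_i\}_{i\in I}$ of submodules of a multiplication module $M$ satisfies property ( * ) if for each $x\in M$ there is an $n\in\mathbb{N}$ such that, for all $i\in I$, $x\in\text{rad}(N_i)$ implies $x^n\subseteq N_i$. *)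

(* Defs.v *)
From mathcomp Require Import all_boot all_order all_algebra.
From mathcomp Require Import all_classical.

Set Implicit Arguments.
Unset Strict Implicit.
Unset Printing Implicit Defensive.

Import GRing.Theory.
Local Open Scope classical_set_scope.
Local Open Scope ring_scope.

Section Submodules.
Context {R : comPzRingType} {M : lmodType R}.
Implicit Types (N P Q : set M) (I : set R) (x m : M) (r : R).

Definition is_submodule N : Prop := GRing.submod_closed (mem N).

Lemma is_submoduleP N :
  is_submodule N <-> N 0 /\ (forall r u v, N u -> N v -> N (r *: u + v)).
Proof.
split=> -[N0 NL]; split.
- by move: N0; rewrite inE.
- by move=> r u v Nu Nv; have := NL r u v; rewrite !inE; apply.
- by rewrite inE.
- by move=> r u v; rewrite !inE; apply: NL.
Qed.

Definition submodule_span (A : set M) : set M := smallest is_submodule A.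

(* I N: all finite sums of products a *: m with a in I and m in N. *)
Definition ideal_smul I N : set M :=
  submodule_span [set a *: m | a in I & m in N].

Definition cyclic_submodule x : set M := [set r *: x | r in [set: R]].

End Submodules.

(* Ideals of R are the submodules of the regular module R^o. *)
Definition is_ideal (R : comPzRingType) (I : set R) : Prop :=
  @is_submodule R R^o I.

Definition ideal_mul (R : comPzRingType) (I J : set R) : set R :=
  @ideal_smul R R^o I J.

Definition ideal_exp (R : comPzRingType) (I : set R) (n : nat) : set R :=
  iter n (ideal_mul I) [set: R].

Definition principal_ideal_ring (R : comPzRingType) : Prop :=
  forall I : set R, is_ideal I ->
    exists a : R, I = [set r * a | r in [set: R]].

Section Modules.
Context {R : comPzRingType} (M : lmodType R).

Definition finitely_generated : Prop :=
  exists s : seq M, submodule_span [set` s] = [set: M].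

Definition faithful : Prop :=
  forall r : R, (forall m : M, r *: m = 0) -> r = 0.

Definition multiplication_module : Prop :=
  forall N : set M, is_submodule N ->
    exists2 I : set R, is_ideal I & N = ideal_smul I [set: M].

Definition prime_submodule (P : set M) : Prop :=
  [/\ is_submodule P, P <> [set: M] &
      forall (r : R) (m : M), P (r *: m) ->
        P m \/ (forall m' : M, P (r *: m'))].

Definition primary_submodule (Q : set M) : Prop :=
  [/\ is_submodule Q, Q <> [set: M] &
      forall (r : R) (m : M), Q (r *: m) ->
        Q m \/ exists2 k : nat, (1 <= k)%N & forall m' : M, Q (r ^+ k *: m')].

Definition maximal_submodule (P : set M) : Prop :=
  [/\ is_submodule P, P <> [set: M] &
      forall N : set M, is_submodule N -> P `<=` N -> N = P \/ N = [set: M]].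

Definition zero_dimensional : Prop :=
  forall P : set M, prime_submodule P -> maximal_submodule P.

(* The empty intersection is [set: M]. *)
Definition submodule_radical (N : set M) : set M :=
  \bigcap_(P in [set P | prime_submodule P /\ N `<=` P]) P.

(* x^n = I^n M for any ideal I with R x = I M. To avoid choosing such an I, we
   take the union over all of them; all the members are equal, see
   [element_powE]. *)
Definition element_pow (x : M) (n : nat) : set M :=
  \bigcup_(I in [set I : set R | is_ideal I /\
                   cyclic_submodule x = ideal_smul I [set: M]])
    ideal_smul (ideal_exp I n) [set: M].

(* The exponent is required to be positive. Since x^0 = M contains x^1, allowing
   n = 0 would give an equivalent property. *)
Definition property_star (F : set (set M)) : Prop :=
  forall x : M, exists2 n : nat, (1 <= n)%N &
    forall N : set M, F N -> submodule_radical N x -> element_pow x n `<=` N.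

End Modules.

Section Independence.
Context {R : comPzRingType} {M : lmodType R}.
Implicit Types (I J : set R) (N : set M).

Lemma submodule_span_submodule (A : set M) : is_submodule (submodule_span A).
Proof.
apply/is_submoduleP; split=> [N [/is_submoduleP[]] //|r u v Au Av N NA].
by case: (NA) => /is_submoduleP[_ NL] _; apply: NL; [apply: Au|apply: Av].
Qed.

Lemma ideal_smul_sub I N P : is_submodule P ->
  (forall a m, I a -> N m -> P (a *: m)) -> ideal_smul I N `<=` P.
Proof.
by move=> subP IN; apply: smallest_sub => // _ [a Ia [m Nm <-]]; apply: IN.
Qed.

Lemma mem_ideal_smul I N a m : I a -> N m -> ideal_smul I N (a *: m).
Proof. by move=> Ia Nm; apply: sub_gen_smallest; exists a => //; exists m. Qed.

Lemma ideal_smulA I J N :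
  ideal_smul (ideal_mul I J) N = ideal_smul I (ideal_smul J N).
Proof.
apply/seteqP; split.
  apply: ideal_smul_sub => [|c m + Nm]; first exact: submodule_span_submodule.
  set P := ideal_smul I _.
  have /is_submoduleP[P0 PL] : is_submodule P by exact: submodule_span_submodule.
  have subT : @is_submodule R R^o [set c : R | P (c *: m)].
    apply/is_submoduleP; split=> [|r u v]; rewrite /= ?scale0r//.
    by move=> Pu Pv; rewrite scalerDl -scalerA; apply: PL.
  apply: (smallest_sub subT) => _ [a Ia [b Jb <-]] /=.
  by rewrite -scalerA; do 2!apply: mem_ideal_smul => //.
apply: ideal_smul_sub => [|a u Ia]; first exact: submodule_span_submodule.
set P := ideal_smul (ideal_mul I J) N.
have /is_submoduleP[P0 PL] : is_submodule P by exact: submodule_span_submodule.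
have subT : is_submodule [set u : M | P (a *: u)].
  apply/is_submoduleP; split=> [|r v w]; rewrite /= ?scaler0//.
  by move=> Pv Pw; rewrite scalerDr scalerA mulrC -scalerA; apply: PL.
apply: (smallest_sub subT) => _ [b Jb [m Nm <-]] /=.
rewrite scalerA; apply: mem_ideal_smul => //.
by apply: sub_gen_smallest; exists a => //; exists b.
Qed.

Lemma ideal_smulC I J N :
  ideal_smul I (ideal_smul J N) = ideal_smul J (ideal_smul I N).
Proof.
rewrite -!ideal_smulA; congr ideal_smul; rewrite /ideal_mul /ideal_smul.
congr (@submodule_span R R^o _); apply/seteqP; split=> _ [a Ia [b Jb <-]];
  by exists b => //; exists a => //; rewrite /GRing.scale/= mulrC.
Qed.

Lemma ideal_exp_smul I J n : ideal_smul I [set: M] = ideal_smul J [set: M] ->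
  ideal_smul (ideal_exp I n) [set: M] = ideal_smul (ideal_exp J n) [set: M].
Proof.
move=> IJ; elim: n => //= n IHn.
by rewrite !ideal_smulA IHn ideal_smulC IJ ideal_smulC.
Qed.

Lemma element_powE (x : M) I n : is_ideal I ->
  cyclic_submodule x = ideal_smul I [set: M] ->
  element_pow x n = ideal_smul (ideal_exp I n) [set: M].
Proof.
move=> idI xI; apply/seteqP; split=> [m [J [_ xJ]]|m Im]; last by exists I.
by rewrite (@ideal_exp_smul J I) // -xJ.
Qed.

End Independence.

(* Main.v *)
(* Every submodule of M has the form aM, and if Rx = aM then x^n = a^n M.

   (i) => (ii): a submodule of the finitely generated M that is maximal among
   those whose residual (P : M) avoids a multiplicative set is prime.  Applied to
   0 and {a^n (1 - ab)}, this gives a^n = a^(n+1) b for some n and b when M is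
   zero-dimensional; applied to N and {a^n}, it gives a^k M <= N for some k when
   x lies in rad(N).  Hence a^n M <= N, with n independent of N.

   (iii) => (i): if a prime P is not maximal, let Q = tM be a maximal submodule
   strictly containing it.  All t^k M, k >= 1, are primary with radical
   containing Q.  Take m outside Q, write Rm = eM and apply the property to
   x = tm: for some n, e^n t^n M <= t^(n+1) M, so t^n M <= t^(n+1) M because
   t^(n+1) M is primary.  As no power of t carries M into P, this gives
   M <= tM + P = Q. *)
Require Import Defs.
From mathcomp Require Import all_boot all_order all_algebra.
From mathcomp Require Import all_classical.

Import GRing.Theory.
Local Open Scope classical_set_scope.
Local Open Scope ring_scope.

Section Submodules.
Set Implicit Arguments.
Unset Strict Implicit.
Context {R : comPzRingType} {M : lmodType R}.
Implicit Types (N P Q X : set M) (a b r s t : R) (m x : M).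

(** * Closure properties and elementary constructions of submodules *)

Section Closure.
Variables (N : set M) (subN : is_submodule N).

Lemma submodule0 : N 0.
Proof. by case/is_submoduleP: subN. Qed.

Lemma submoduleZ r {m} : N m -> N (r *: m).
Proof.
case/is_submoduleP: subN => N0 NL Nm.
by rewrite -[_ *: _]addr0; apply: NL.
Qed.

Lemma submoduleD {x m} : N x -> N m -> N (x + m).
Proof.
case/is_submoduleP: subN => _ NL Nx Nm.
by rewrite -[x]scale1r; apply: NL.
Qed.

Lemma submodule_preim_scale s : is_submodule [set m | N (s *: m)].
Proof.
apply/is_submoduleP; split=> [|r u v] /=; rewrite ?scaler0; first exact: submodule0.
move=> Nu Nv; rewrite scalerDr scalerA mulrC -scalerA.
by apply: submoduleD => //; apply: submoduleZ.
Qed.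

Lemma submodule_scale a : is_submodule ( *:%R a @` N).
Proof.
apply/is_submoduleP; split=> [|r _ _ [u Nu <-] [v Nv <-]].
  by exists 0; [exact: submodule0|rewrite scaler0].
exists (r *: u + v); first by apply: submoduleD => //; apply: submoduleZ.
by rewrite scalerDr !scalerA mulrC.
Qed.

(** The set is the sum N + X, with the component in X written as a difference. *)
Lemma submodule_add X : is_submodule X ->
  is_submodule [set u | exists2 x, N x & X (u - x)].
Proof.
move=> subX; apply/is_submoduleP; split.
  exists 0; first exact: submodule0.
  by rewrite subr0; case/is_submoduleP: subX.
move=> r u v [x Nx Xx] [y Ny Xy]; exists (r *: x + y).
  by apply: submoduleD => //; apply: submoduleZ.
case/is_submoduleP: subX => _ XL.
by rewrite opprD addrACA -scalerBr; apply: XL.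
Qed.

Lemma principal_ideal_smul a :
  ideal_smul [set r * a | r in [set: R]] N = *:%R a @` N.
Proof.
apply/seteqP; split.
  apply: ideal_smul_sub => [|_ m [r _ <-] Nm]; first exact: submodule_scale.
  exists (r *: m); first exact: submoduleZ.
  by rewrite scalerA mulrC.
move=> _ [m Nm <-]; apply: mem_ideal_smul => //.
by exists 1 => //; rewrite mul1r.
Qed.

End Closure.

Lemma submoduleT : is_submodule [set: M].
Proof. by apply/is_submoduleP. Qed.

Lemma submodule_zero : is_submodule [set (0 : M)].
Proof. by apply/is_submoduleP; split=> // r _ _ -> ->; rewrite scaler0 addr0. Qed.

Lemma submodule_cyclic m : is_submodule (cyclic_submodule m).
Proof.
apply/is_submoduleP; split=> [|r _ _ [u _ <-] [v _ <-]].
  by exists 0 => //; rewrite scale0r.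
by exists (r * u + v) => //; rewrite scalerDl scalerA.
Qed.

Lemma cyclic_self m : cyclic_submodule m m.
Proof. by exists 1 => //; rewrite scale1r. Qed.

(** * Principal ideals and powers of elements *)

Lemma is_ideal_principal a : is_ideal [set r * a | r in [set: R]].
Proof.
apply/is_submoduleP; split=> [|r _ _ [u _ <-] [v _ <-]].
  by exists 0 => //; rewrite mul0r.
by exists (r * u + v) => //; rewrite mulrDl -mulrA.
Qed.

Lemma principal_ideal_exp_smul a n :
  ideal_smul (ideal_exp [set r * a | r in [set: R]] n) [set: M]
  = range (fun m => a ^+ n *: m).
Proof.
elim: n => [|n IHn] /=.
  apply/seteqP; split=> m _; first by exists m; rewrite // expr0 scale1r.
  by rewrite -[m]scale1r; apply: mem_ideal_smul.
rewrite ideal_smulA IHn principal_ideal_smul; last exact: submodule_scale submoduleT _.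
apply/seteqP; split=> [_ [_ [m _ <-] <-]|_ [m _ <-]].
  by exists m => //; rewrite exprS scalerA.
by exists (a ^+ n *: m); [exists m|rewrite scalerA exprS].
Qed.

Lemma element_pow_principal x a n : cyclic_submodule x = range ( *:%R a) ->
  element_pow x n = range (fun m => a ^+ n *: m).
Proof.
move=> xa; rewrite -principal_ideal_exp_smul.
apply: element_powE; first exact: is_ideal_principal.
by rewrite xa principal_ideal_smul//; apply: submoduleT.
Qed.

Lemma submodule_principal N : principal_ideal_ring R -> multiplication_module M ->
  is_submodule N -> exists a, N = range ( *:%R a).
Proof.
move=> pir mult /mult[I /pir[a ->] ->]; exists a.
by apply: principal_ideal_smul; apply: submoduleT.
Qed.

(** * Submodules maximal among those whose residual avoids a set of scalars *)

(** This says that S is disjoint from the residual (N : M). *)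
Definition avoids (S : set R) N := forall s, S s -> exists m, ~ N (s *: m).

Lemma avoidsPn S N : ~ avoids S N -> exists2 s, S s & forall m, N (s *: m).
Proof.
move=> /existsNP[s /not_implyP[Ss /forallNP Ns]].
by exists s => // m; apply: contrapT.
Qed.

Lemma chain_bigcup_finite (F : set (set M)) X0 (l : seq M) :
  F X0 -> total_on F subset -> {in l, forall g, (\bigcup_(X in F) X) g} ->
  exists2 X, F X & {in l, forall g, X g}.
Proof.
move=> F0 totF; elim: l => [|g l IHl] Fl; first by exists X0.
have [u ul|X FX Xl] := IHl; first by apply: Fl; rewrite inE ul orbT.
have [Y FY Yg] := Fl g (mem_head _ _).
have [XY|YX] := totF _ _ FX FY; [exists Y|exists X] => // u.
  by rewrite inE => /predU1P[->//|/Xl/XY].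
by rewrite inE => /predU1P[->|/Xl//]; apply: YX.
Qed.

(** Zorn's lemma. If s carries M into the union of a chain, the images under s of the finitely many
    generators already lie in one member, and then so does sM. *)
Lemma exists_maximal_avoiding (S : set R) N : finitely_generated M ->
  is_submodule N -> avoids S N ->
  exists P, [/\ is_submodule P, N `<=` P, avoids S P &
    forall X, is_submodule X -> P `<=` X -> avoids S X -> X = P].
Proof.
move=> [l gen_l] subN avN.
(* Only N `|` X is constrained, so that the empty chain has the bound set0. *)
pose good X := is_submodule (N `|` X) /\ avoids S (N `|` X).
have [F Fgood totF|P [[subP avP] maxP]] := @Zorn_bigcup _ good.
  have [->|/set0P[X0 F0]] := eqVneq F set0.
    by rewrite bigcup_set0 /good setU0.
  have FU u : (N `|` \bigcup_(X in F) X) u -> exists2 X, F X & (N `|` X) u.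
    by case=> [Nu|[X FX Xu]]; [exists X0 => //; left|exists X => //; right].
  have UF X u : F X -> (N `|` X) u -> (N `|` \bigcup_(X in F) X) u.
    by move=> FX [Nu|Xu]; [left|right; exists X].
  have subU : is_submodule (N `|` \bigcup_(X in F) X).
    apply/is_submoduleP; split; first by left; apply: submodule0.
    move=> r u v /FU[X FX Xu] /FU[Y FY Yv].
    have combine Z : F Z -> (N `|` Z) u -> (N `|` Z) v ->
        (N `|` \bigcup_(X in F) X) (r *: u + v).
      move=> FZ Zu Zv; apply: (UF Z) => //.
      by case: (Fgood _ FZ) => /is_submoduleP[_ ZL] _; apply: ZL.
    have [XY|YX] := totF _ _ FX FY.
      by apply: (combine Y) => //; apply: setUS Xu.
    by apply: (combine X) => //; apply: setUS Yv.
  split=> // s Ss; apply/existsNP => sU.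
  pose G := [set N `|` X | X in F].
  have totG : total_on G subset.
    by move=> _ _ [X FX <-] [Y FY <-]; have [XY|YX] := totF _ _ FX FY;
      [left|right]; apply: setUS.
  have [|||_ [X FX <-] Xl] := @chain_bigcup_finite G (N `|` X0) (map ( *:%R s) l).
  - by exists X0.
  - exact: totG.
  - move=> _ /mapP[g _ ->]; have [X FX Xg] := FU _ (sU g).
    by exists (N `|` X) => //; exists X.
  have [subX /(_ s Ss)[m]] := Fgood _ FX; apply.
  have : submodule_span [set` l] m by rewrite gen_l.
  apply: (smallest_sub (submodule_preim_scale subX s)) => g /= gl.
  by apply: Xl; apply: map_f.
exists (N `|` P); split=> // X subX NPX avX; apply/seteqP; split=> //.
have NX : N `|` X = X by apply/setUidPr => u Nu; apply: NPX; left.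
apply: contrapT => XNP; apply: (maxP X); last by rewrite /good NX.
split=> [u Pu|XP]; last by apply: XNP => u /XP; right.
by apply: NPX; right.
Qed.

(** A submodule P maximal among those avoiding S is prime: if rm lies in P but m and rM do not, then
    P + Rm and P + rM are strictly larger, so they contain sM and tM for some s, t in S, and stM
    falls into P. *)
Lemma exists_prime_avoiding (S : set R) N : finitely_generated M ->
  S 1 -> (forall s t, S s -> S t -> S (s * t)) ->
  is_submodule N -> avoids S N ->
  exists P, [/\ prime_submodule P, N `<=` P & avoids S P].
Proof.
move=> fg S1 SM subN avN.
have [P [subP NP avP maxP]] := exists_maximal_avoiding fg subN avN.
exists P; split=> //; split=> //.
  by move=> PT; have [m] := avP 1 S1; rewrite PT; apply.
have hits X : is_submodule X -> ~ X `<=` P ->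
    exists2 s, S s & forall m, exists2 p, P p & X (s *: m - p).
  move=> subX XP; have subPX := submodule_add subP subX.
  apply: (@avoidsPn S [set u | exists2 p, P p & X (u - p)]) => avPX.
  apply: XP => u Xu; rewrite -(maxP _ subPX) => [||//].
    by exists 0; [exact: submodule0|rewrite subr0].
  by move=> p Pp; exists p => //; rewrite subrr; apply: submodule0.
move=> r m Prm; have [Pm|nPm] := pselect (P m); first by left.
right; apply: contrapT => nPr.
have [||s Ss sP] := hits (cyclic_submodule m).
- exact: submodule_cyclic.
- by move=> /(_ _ (cyclic_self m)).
have [||t St tP] := hits (range ( *:%R r)).
- exact: submodule_scale submoduleT _.
- by move=> rP; apply: nPr => u; apply: rP; exists u.
(* With tu = rv + p and sv = wm + q, where p and q lie in P, one gets stu = w(rm) + rq + sp, which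
   is in P. *)
have [u] := avP _ (SM _ _ Ss St); apply; rewrite -scalerA.
have [p Pp [v _ v_def]] := tP u; have [q Pq [w _ w_def]] := sP v.
have -> : t *: u = r *: v + p by rewrite v_def subrK.
have sv : s *: v = w *: m + q by rewrite w_def subrK.
rewrite scalerDr scalerA mulrC -scalerA sv scalerDr scalerA mulrC -scalerA.
by do 2?apply: submoduleD => //; apply: submoduleZ.
Qed.

(** * Prime and maximal submodules *)

Lemma prime_submoduleX P t n m : prime_submodule P -> P (t ^+ n *: m) ->
  P m \/ forall m', P (t *: m').
Proof.
move=> [_ _ prP]; elim: n => [|n IHn]; first by rewrite expr0 scale1r; left.
by rewrite exprS -scalerA => /prP[/IHn//|]; right.
Qed.

(** By maximality Q + Rm is all of M. *)
Lemma maximal_submodule_scalar Q x m : maximal_submodule Q -> ~ Q m ->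
  exists s, Q (x - s *: m).
Proof.
move=> [subQ _ maxQ] nQm.
have [||QX|XT] :=
    maxQ [set u | exists2 y, cyclic_submodule m y & Q (u - y)].
- exact: submodule_add (submodule_cyclic m) _ subQ.
- move=> q Qq; exists 0; last by rewrite subr0.
  by apply: submodule0; apply: submodule_cyclic.
- case: nQm; rewrite -QX; exists m; first exact: cyclic_self.
  by rewrite subrr; apply: submodule0.
have : [set: M] x by [].
by rewrite -XT => -[_ [s _ <-] Qs]; exists s.
Qed.

Lemma maximal_submodule_prime Q : maximal_submodule Q -> prime_submodule Q.
Proof.
move=> maxQ; have [subQ QT _] := maxQ; split=> // r m Qrm.
have [Qm|nQm] := pselect (Q m); [by left|right=> u].
have [s Qs] := maximal_submodule_scalar u maxQ nQm.
rewrite -(subrK (s *: m) u) scalerDr; apply: submoduleD => //.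
  exact: submoduleZ.
by rewrite scalerA mulrC -scalerA; apply: submoduleZ.
Qed.

(** The ring R/(Q : M) is a field. If rm is outside Q, then m is congruent to some s(rm) modulo Q;
    as m is outside Q too, primality puts 1 - rs in the residual. *)
Lemma maximal_submodule_inv Q r : maximal_submodule Q ->
  ~ (forall m, Q (r *: m)) -> exists s, forall m, Q ((1 - r * s) *: m).
Proof.
move=> maxQ /existsNP[m nQrm].
have [_ _ prQ] := maximal_submodule_prime maxQ.
have [s Qs] := maximal_submodule_scalar m maxQ nQrm; exists s.
have [|Qm|//] := prQ (1 - r * s) m; first by rewrite scalerBl scale1r mulrC -scalerA.
by case: nQrm; apply: submoduleZ => //; case: maxQ.
Qed.

(** A submodule avoids the set {1} exactly when it is proper. *)
Lemma exists_maximal_submodule N : finitely_generated M -> is_submodule N ->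
  N <> [set: M] -> exists2 Q, maximal_submodule Q & N `<=` Q.
Proof.
move=> fg subN NT; have av1 X : X <> [set: M] -> avoids [set 1] X.
  move=> XT _ ->; apply/existsNP => X1; apply: XT; apply/seteqP; split=> // u _.
  by rewrite -[u]scale1r.
have [Q [subQ NQ avQ maxQ]] := exists_maximal_avoiding fg subN (av1 _ NT).
exists Q => //; split=> // [QT|X subX QX].
  by have [m] := avQ 1 erefl; rewrite QT; apply.
by have [XT|/av1 avX] := pselect (X = [set: M]); [right|left; apply: maxQ].
Qed.

(** * Powers of a maximal submodule tM are primary *)

Lemma range_scaleX r t k : (forall m, range ( *:%R t) (r *: m)) ->
  forall m, range ( *:%R (t ^+ k)) (r ^+ k *: m).
Proof.
move=> rt; elim: k => [|k IHk] m; first by exists m.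
have [u _ u_def] := rt m; have [v _ v_def] := IHk u.
by exists v; rewrite // [r ^+ _]exprSr -scalerA -u_def scalerA mulrC -scalerA -v_def scalerA -exprS.
Qed.

Lemma subrXX_mul r s k : exists s', (1 - r * s) ^+ k = 1 - r * s'.
Proof.
elim: k => [|k [s' IHk]]; first by exists 0; rewrite mulr0 subr0.
exists (s + s' - s * r * s').
by rewrite exprS IHk !mulrBr mulrDr !mulrBl !mul1r mulr1 !opprD !opprK !addrA !mulrA.
Qed.

(** If r does not carry M into tM, some 1 - rs does. Its power of exponent k + 1 carries M into
    t^(k+1) M and has the form 1 - rs', so m = (1 - rs')m + s'(rm) lies in t^(k+1) M as soon as rm
    does. *)
Lemma maximal_power_primary t k : maximal_submodule (range ( *:%R t) : set M) ->
  primary_submodule (range ( *:%R (t ^+ k.+1)) : set M).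
Proof.
move=> maxQ; have [subQ QT _] := maxQ.
have subT := submodule_scale submoduleT (t ^+ k.+1).
split=> // [kT|r m tkrm].
  apply: QT; apply/seteqP; split=> // u _.
  have [v _ <-] : range ( *:%R (t ^+ k.+1)) u by rewrite kT.
  by exists (t ^+ k *: v); rewrite // scalerA -exprS.
have [rQ|nrQ] := pselect (forall m, range ( *:%R t) (r *: m)).
  by right; exists k.+1 => //; apply: range_scaleX.
have [s sQ] := maximal_submodule_inv maxQ nrQ; left.
have [s' s'_def] := subrXX_mul r s k.+1.
rewrite -[m]scale1r -(subrK (r * s') 1) scalerDl -s'_def.
apply: submoduleD => //; first exact: range_scaleX.
by rewrite mulrC -scalerA; apply: submoduleZ.
Qed.

Lemma zero_dimensional_stationary a : finitely_generated M -> faithful M ->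
  zero_dimensional M -> exists n b, a ^+ n * (1 - a * b) = 0.
Proof.
move=> fg faith dim0; apply: contrapT => no_nb.
pose S : set R := [set s | exists n b, s = a ^+ n * (1 - a * b)].
have S1 : S 1 by exists 0%N, 0; rewrite mulr0 subr0 mulr1.
have SM s t : S s -> S t -> S (s * t).
  (* The second witness comes from (1 - ab)(1 - ac) = 1 - a(b + c - bac). *)
  move=> [n [b ->]] [k [c ->]]; exists (n + k)%N, (b + c - b * a * c).
  rewrite mulrACA -exprD; congr (_ * _).
  by rewrite !mulrBr mulrDr !mulrBl !mul1r mulr1 !opprD !opprK !addrA !mulrA.
have [|P [prP _ avP]] := exists_prime_avoiding fg S1 SM submodule_zero.
  move=> s [n [b ->]]; apply/existsNP => s0; apply: no_nb; exists n, b.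
  exact: faith.
have maxP := dim0 _ prP.
(* The set S contains a (n = 1, b = 0), so a is invertible modulo the residual of P, with some
   inverse s; but S also contains 1 - as. *)
have [|s Ps] := maximal_submodule_inv (r := a) maxP.
  move=> aP; have [|m] := avP a; last by apply.
  by exists 1%N, 0; rewrite mulr0 subr0 mulr1.
by have [|m] := avP (1 - a * s); [exists 0%N, s; rewrite mul1r|apply].
Qed.

(** Substituting a^n = a(a^n b) into itself extracts k factors a. Thus a^n M lies in a^k M for every
    k, which frees the exponent n from the submodule. *)
Lemma stationary_power a b n k : a ^+ n * (1 - a * b) = 0 ->
  a ^+ n = a ^+ k * (a ^+ n * b ^+ k).
Proof.
move=> ab0; have an : a ^+ n = a * (a ^+ n * b).
  by apply/eqP; rewrite mulrCA -subr_eq0 -[X in X - _]mulr1 -mulrBr ab0.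
elim: k => [|k IHk]; first by rewrite !mul1r mulr1.
by rewrite [LHS]IHk exprSr -mulrA; congr (_ * _); rewrite exprS [in LHS]an -!mulrA.
Qed.

(** Otherwise a prime P containing N avoids all powers of a; but x is in P, so aM = Rx lies in P. *)
Lemma radical_power N x a : finitely_generated M -> is_submodule N ->
  cyclic_submodule x = range ( *:%R a) -> submodule_radical N x ->
  exists k, forall m, N (a ^+ k *: m).
Proof.
move=> fg subN xa radx; apply: contrapT => no_k.
pose S : set R := range (GRing.exp a).
have S1 : S 1 by exists 0%N.
have SM s t : S s -> S t -> S (s * t).
  by move=> [n _ <-] [k _ <-]; exists (n + k)%N; rewrite // exprD.
have [|P [prP NP avP]] := exists_prime_avoiding fg S1 SM subN.
  by move=> _ [k _ <-]; apply/existsNP => kN; apply: no_k; exists k.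
have [|m] := avP a; first by exists 1%N.
apply; have [subP _ _] := prP.
have [r _ <-] : cyclic_submodule x (a *: m) by rewrite xa; exists m.
by apply: submoduleZ => //; apply: radx.
Qed.

Lemma zero_dimensional_property_star : principal_ideal_ring R ->
  finitely_generated M -> faithful M -> multiplication_module M ->
  zero_dimensional M -> property_star (fun N : set M => is_submodule N).
Proof.
move=> pir fg faith mult dim0 x.
have [a xa] := submodule_principal pir mult (submodule_cyclic x).
have [n [b ab0]] := zero_dimensional_stationary a fg faith dim0.
(* The stationary exponent n may be 0, while the property asks for a positive one. *)
exists n.+1 => // N subN radx; rewrite (element_pow_principal _ xa) => _ [m _ <-].
have [k kN] := radical_power fg subN xa radx.
by rewrite exprS (stationary_power k ab0) mulrCA -scalerA.
Qed.

Lemma power_radical t k m : submodule_radical (range ( *:%R (t ^+ k))) (t *: m : M).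
Proof.
move=> P [prP kP].
have [subP _ _] := prP; have Pkm : P (t ^+ k *: m) by apply: kP; exists m.
by have [Pm|] := prime_submoduleX prP Pkm; [apply: submoduleZ|apply].
Qed.

Lemma property_star_primary_zero_dimensional : principal_ideal_ring R ->
  finitely_generated M -> multiplication_module M ->
  property_star (fun N : set M => primary_submodule N) -> zero_dimensional M.
Proof.
move=> pir fg mult star P prP; have [subP PT _] := prP; split=> // N subN PN.
have [NT|/(exists_maximal_submodule fg subN)[Q maxQ NQ]] :=
  pselect (N = [set: M]); [by right|left].
apply/seteqP; split=> // y Ny; apply: contrapT => nPy.
have [subQ QT _] := maxQ.
have [t Qt] := submodule_principal pir mult subQ; subst Q.
have [m nQm] : exists m, ~ range ( *:%R t) m.
  by apply/existsNP => Qm; apply: QT; apply/seteqP; split.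
have [e me] := submodule_principal pir mult (submodule_cyclic m).
have tm_te : cyclic_submodule (t *: m) = range ( *:%R (t * e)).
  apply/seteqP; split=> [_ [r _ <-]|_ [u _ <-]].
    have [u _ u_def] : range ( *:%R e) (r *: m) by rewrite -me; exists r.
    by exists u; rewrite // -scalerA u_def !scalerA mulrC.
  have [r _ r_def] : cyclic_submodule m (e *: u) by rewrite me; exists u.
  by exists r; rewrite // -scalerA -r_def !scalerA mulrC.
(* The exponent n is fixed before the primary submodule is chosen, so it can be applied to t^(n+1)
   M, one power beyond n. *)
have [n _ star_n] := star (t *: m).
have primT := maximal_power_primary n maxQ.
have [subT _ prT] := primT.
have teT : range (fun u : M => (t * e) ^+ n *: u) `<=` range ( *:%R (t ^+ n.+1)).
  rewrite -(element_pow_principal n tm_te); apply: star_n => //.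
  exact: power_radical.
(* Since Q is prime, a power of e carrying M into Q would put m itself or eM = Rm in Q. *)
have eQ k : ~ forall u : M, range ( *:%R t) (e ^+ k *: u).
  move=> ekQ; apply: nQm.
  have [//|eQ] := prime_submoduleX (maximal_submodule_prime maxQ) (ekQ m).
  have [u _ <-] : range ( *:%R e) m by rewrite -me; apply: cyclic_self.
  exact: eQ.
(* Primality up to powers is applied to e^n and t^n u; its second alternative would carry M into
   t^(n+1) M, hence into Q, by a power of e. *)
have tnT (u : M) : range ( *:%R (t ^+ n.+1)) (t ^+ n *: u).
  have [|//|[k _ ekT]] := prT (e ^+ n) (t ^+ n *: u).
    by rewrite scalerA mulrC -exprMn; apply: teT; exists u.
  case: (eQ (n * k)%N) => v; have [w _ w_def] := ekT v.
  by exists (t ^+ n *: w); rewrite // exprM -w_def scalerA -exprS.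
(* From t^n m = t^(n+1) m' one has t^n (m - tm') = 0, which lies in P. Either m - tm' is in P, hence
   in Q, and m is in Q, or tM = Q lies in P, against y in N outside P. *)
apply: nQm; have [m' _ m'_def] := tnT m.
rewrite -(subrK (t *: m') m); apply: submoduleD => //.
apply: (NQ); apply: PN.
have [|//|tP] := @prime_submoduleX P t n (m - t *: m') prP.
  by rewrite scalerBr scalerA -exprSr m'_def subrr; apply: submodule0.
by case: nPy; have [z _ <-] := NQ _ Ny; apply: tP.
Qed.

Lemma primary_submodule_property_star :
  property_star (fun N : set M => is_submodule N) ->
  property_star (fun N : set M => primary_submodule N).
Proof.
by move=> star x; have [n n1 nP] := star x; exists n => // N [subN _ _]; apply: nP.
Qed.

End Submodules.

Theorem theorem5p3 (R : comPzRingType) (M : lmodType R)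
    (R_pir : principal_ideal_ring R)
    (M_fg : finitely_generated M)
    (M_faithful : faithful M)
    (M_mult : multiplication_module M) :
  (zero_dimensional M <->
     property_star (fun N : set M => is_submodule N)) /\
  (property_star (fun N : set M => is_submodule N) <->
     property_star (fun N : set M => primary_submodule N)).
Proof.
have i_ii := zero_dimensional_property_star R_pir M_fg M_faithful M_mult.
have iii_i := property_star_primary_zero_dimensional R_pir M_fg M_mult.
have ii_iii := @primary_submodule_property_star R M.
by split; [split=> [/i_ii|/ii_iii/iii_i]|split=> [/ii_iii|/iii_i/i_ii]].
Qed.
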